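(* If $p \in \mathbb{M}_2(\mathbb{C})$ is a projection with $p \neq 0$ and $p \neq 1$, then $p \in \mathcal{P}^2_{i,j}(\mathbb{C})$; that is, there exist indices $i \neq j$ in $\{1,2\}$ and a complex number $a$ such that $p = P_{i,j}(a)$.
   Context: A projection is an element $p$ with $p = p^* = p^2$. For a unital $C^*$-algebra $A$, an element $a \in A$ and indices $i \neq j$, $1 \le i,j \le n$, the projection $P_{i,j}(a) \in \mathbb{M}_n(A) \cong A \otimes \mathbb{M}_n(\mathbb{C})$ is $$P_{i,j}(a) = (1+aa^* )^{-1}\otimes E_{i,i} + (1+aa^* )^{-1}a \otimes E_{i,j} + a^*(1+aa^* )^{-1}\otimes E_{j,i} + a^*(1+aa^* )^{-1}a \otimes E_{j,j},$$ where $E_{k,l}$ are the standard matrix units of $\mathbb{M}_n(\mathbb{C})$. $\mathcal{P}^n_{i,j}(A)$ denotes the family of all projections in $\mathbb{M}_n(A)$ of the form $P_{i,j}(a)$ with $1 \le i,j \le n$, $i \ne j$, $a \in A$ (the indices $i,j$ range over all such pairs). Here $A = \mathbb{C}$, $n = 2$. *)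

(* Defs.v *)
From mathcomp Require Import all_boot all_algebra.
From mathcomp Require Import reals complex.

Set Implicit Arguments.
Unset Strict Implicit.
Unset Printing Implicit Defensive.

Import GRing.Theory.
Local Open Scope ring_scope.
Local Open Scope sesquilinear_scope.

(* [star] is the adjoint map a |-> a^* of the coefficient algebra [A], and
   [p ^t star] (the entrywise star of the transpose) is the adjoint in M_n(A).
   Neither the C*-norm nor the laws of [star] enter the definitions below. *)

Definition is_projection (A : pzRingType) (star : A -> A) (n : nat)
    (p : 'M[A]_n) : Prop :=
  p = p ^t star /\ p = p *m p.

(* [b (x) E_{k,l}] is [b *: delta_mx k l].  In a C*-algebra 1 + a a^* is always
   invertible, so the convention x^-1 = x for non-units is irrelevant there. *)
Definition Pij (A : unitRingType) (star : A -> A) (n : nat) (i j : 'I_n)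
    (a : A) : 'M[A]_n :=
  let c := (1 + a * star a)^-1 in
  c *: delta_mx i i + (c * a) *: delta_mx i j
  + (star a * c) *: delta_mx j i + (star a * c * a) *: delta_mx j j.

Definition Pij_family (A : unitRingType) (star : A -> A) (n : nat)
    (p : 'M[A]_n) : Prop :=
  is_projection star p /\
  exists (i j : 'I_n) (a : A), i != j /\ p = Pij star i j a.

(* Main.v *)
(* Write p = [[x, y], [y', z]] with y' the conjugate of y.  If x <> 0, then
   p = p^2 and p <> 1 force x + z = 1 and x = x^2 + y y', so that a = y / x
   satisfies 1 + a a' = 1 / x and p = P_{1,2}(a).  If x = 0, then y = 0 and
   z = 1, so p = E_{2,2} = P_{2,1}(0). *)
Require Import Defs.
From mathcomp Require Import all_boot all_algebra.
From mathcomp Require Import reals complex.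
From mathcomp Require Import ring.

Import GRing.Theory.
Local Open Scope ring_scope.

Lemma matrix2P (A : Type) (p q : 'M[A]_2) :
  p 0 0 = q 0 0 -> p 0 1 = q 0 1 -> p 1 0 = q 1 0 -> p 1 1 = q 1 1 -> p = q.
Proof.
move=> h00 h01 h10 h11; apply/matrixP => i j.
have ord2 (k : 'I_2) : k = 0 \/ k = 1.
  by case: k => [[|[|k]] hk] //; [left | right]; apply: val_inj.
by case: (ord2 i) => ->; case: (ord2 j) => ->.
Qed.

Theorem proposition2p1 (R : realType) (p : 'M[R[i]]_2)
    (hp : is_projection (@conjc R) p) (hp0 : p <> 0) (hp1 : p <> 1) :
  Pij_family (@conjc R) p.
Proof.
split=> //; case: hp => hadj hidem.
have adjE i j : p i j = conjc (p j i) by rewrite {1}hadj !mxE.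
have idemE i j : p i j = p i 0 * p 0 j + p i 1 * p 1 j.
  rewrite {1}hidem !mxE !big_ord_recl big_ord0 addr0.
  (* The second summand is indexed by a lift of [ord0], which agrees with [1] only through its
     value. *)
  by congr (_ + p i _ * p _ j); apply: val_inj.
have h10 := adjE 1 0; have xreal := esym (adjE 0 0).
have hx := idemE 0 0; have hy := idemE 0 1; have hz := idemE 1 1.
rewrite h10 in hx hz.
have idem01 (u : R[i]) : u = u * u -> u = 0 \/ u = 1.
  move=> hu; have /eqP : u * (u - 1) = 0 by rewrite mulrBr mulr1 -hu subrr.
  by rewrite mulf_eq0 subr_eq0 => /orP[] /eqP; [left | right].
have [x0|x_neq0] := eqVneq (p 0 0) 0.
- have y0 : p 0 1 = 0.
    (* With x = 0, [hx] reduces to y y' = 0. *)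
    apply/eqP; move/esym/eqP: hx; rewrite x0 mul0r add0r mulf_eq0.
    by rewrite conjc_eq0 orbb.
  rewrite y0 conjc0 mul0r add0r in hz.
  have z1 : p 1 1 = 1.
    case: (idem01 _ hz) => // z0; case: hp0.
    by apply: matrix2P; rewrite ?h10 ?x0 ?y0 ?z0 ?conjc0 !mxE.
  exists 1, 0, 0; split=> //.
  rewrite /Pij conjc0 !(mul0r, mulr0, addr0, invr1).
  by apply: matrix2P; rewrite ?h10 ?x0 ?y0 ?z1 ?conjc0 !mxE /=
    ?(mul0r, mulr0, addr0, mulr1).
- have tr1 : p 1 1 = 1 - p 0 0.
    have [y0|y_neq0] := eqVneq (p 0 1) 0; last first.
      (* Here [hy] reads y = x y + y z, and y can be cancelled. *)
      by apply: (mulfI y_neq0); rewrite mulrBr {2}hy; ring.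
    (* For y = 0 both x and z are idempotent scalars; x = 1 since x <> 0, and z = 1 would give p =
       1. *)
    rewrite y0 mul0r addr0 in hx; rewrite y0 conjc0 mul0r add0r in hz.
    case: (idem01 _ hx) => [x0|x1]; first by rewrite x0 eqxx in x_neq0.
    case: (idem01 _ hz) => z1; first by rewrite z1 x1 subrr.
    case: hp1.
    by apply: matrix2P; rewrite ?h10 ?x1 ?y0 ?z1 ?conjc0 !mxE.
  have yyE : p 0 1 * conjc (p 0 1) = p 0 0 - p 0 0 * p 0 0.
    by rewrite [X in X - _]hx; ring.
  (* The diagonal entry x is self-conjugate, so a' = y' / x. *)
  have aconj : conjc (p 0 1 / p 0 0) = conjc (p 0 1) / p 0 0.
    by rewrite rmorphM /= fmorphV /= xreal.
  have cE : (1 + p 0 1 / p 0 0 * conjc (p 0 1 / p 0 0))^-1 = p 0 0.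
    (* 1 + a a' = 1 + (x - x^2) / x^2 = 1 / x. *)
    rewrite aconj mulrACA yyE; apply: invr_inj; rewrite invrK; field.
    exact: x_neq0.
  exists 0, 1, (p 0 1 / p 0 0); split=> //.
  rewrite /Pij cE aconj; apply: matrix2P;
    rewrite ?h10 !mxE /= ?(mulr0, mulr1, addr0, add0r) //.
  + by rewrite mulrC divfK.
  + by rewrite divfK.
  (* The last entry is a' x a = y y' / x = (x - x^2) / x = 1 - x = z. *)
  + by rewrite divfK // mulrA [_ * p 0 1]mulrC yyE tr1; field.
Qed.
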